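(* $z_L(6,6)\ge 20$.
   Context: **Classical Zarankiewicz number.** For $m\ge n\ge 2$, $z(m,n)$ is the maximum number of edges in a bipartite graph with parts $S=[m]=\{1,\dots,m\}$ and $T=[n]=\{1,\dots,n\}$ that contains no $K_{2,2}$ (equivalently, no cycle $C_4$). **Limited augmented bipartite graphs.** Let $G_1=(S,T,E_1)$ with $S=[m]$, $T=[n]$ be a $C_4$-free bipartite graph with $|E_1|=z(m,n)$. A limited augmented bipartite graph $G=(S,T,E_1\cup E_2)$ augmented from $G_1$ consists of the set $E_1$ of 1-edges (pairs, or ''cells'', $(i,j)\in S\times T$) and a set $E_2$ of 2-edges. A 2-edge is a quadruple $(i,j;k,l)$ with $i,k\in S$, $j,l\in T$, where the case $i=k$ and $j=l$ is forbidden; it is regarded as an unordered pair of the two distinct cells $(i,j)$ and $(k,l)$, called its halves. It is nondegenerate if $i\ne k$ and $j\ne l$, row-degenerate if $i=k$ and $j\neq l$, and column-degenerate if $i\ne k$ and $j=l$. The simplicity condition is imposed: no 2-edge shares a cell with any 1-edge or with another 2-edge. **Generalized $C_4$-cycles.** A cell $(i,j)$ is occupied if $(i,j)\in E_1$ or $(i,j)$ is a half of some 2-edge in $E_2$. The graph $G$ contains a generalized $C_4$-cycle if any of the following holds: 1. There is a classical $C_4$-cycle formed by 1-edges. 2. There is a nondegenerate 2-edge $(i,j;k,l)\in E_2$ such that both cells $(i,l)$ and $(k,j)$ are occupied. 3. There are a 2-edge $(i,j;p,q)\in E_2$ (of any type) and a cell $(k,l)$ with $k\notin\{i,p\}$ and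 $l\notin\{j,q\}$ such that the five cells $(k,l),(k,j),(k,q),(i,l),(p,l)$ are all occupied; if the 2-edge is nondegenerate, these five cells must moreover be pairwise distinct. **Limited augmented Zarankiewicz number.** $z_L(m,n)$ is the maximum of $|E_1|+|E_2|$ over all $m\times n$ limited augmented bipartite graphs $G=(S,T,E_1\cup E_2)$ (augmented from a $C_4$-free graph with $|E_1|=z(m,n)$, satisfying the simplicity condition) that contain no generalized $C_4$-cycle. *)

(* Defs.v *)
From mathcomp Require Import all_boot.

Set Implicit Arguments.
Unset Strict Implicit.
Unset Printing Implicit Defensive.

Section Zarankiewicz.

Variables m n : nat.

(* The parts S = [m] and T = [n] are 'I_m and 'I_n (indices start at 0). *)
Definition cell := ('I_m * 'I_n)%type.

Definition has_C4 (E1 : {set cell}) : bool :=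
  [exists i : 'I_m, exists k : 'I_m, exists j : 'I_n, exists l : 'I_n,
    [&& i != k, j != l,
        (i, j) \in E1, (i, l) \in E1, (k, j) \in E1 & (k, l) \in E1]].

Definition zarankiewicz : nat :=
  \max_(E1 : {set cell} | ~~ has_C4 E1) #|E1|.

(* A 2-edge (i,j;k,l) is the unordered pair {(i,j), (k,l)} of its halves, i.e.
   a set of exactly two cells. *)
Definition all_two_edges (E2 : {set {set cell}}) : bool := [forall e in E2, #|e| == 2].

Definition simplicity (E1 : {set cell}) (E2 : {set {set cell}}) : bool :=
  [forall e in E2, [disjoint e & E1]] &&
  [forall e in E2, forall f in E2, (e != f) ==> [disjoint e & f]].

Definition limited_augmented (E1 : {set cell}) (E2 : {set {set cell}}) : bool :=
  [&& ~~ has_C4 E1, #|E1| == zarankiewicz, all_two_edges E2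
    & simplicity E1 E2].

Definition occupied (E1 : {set cell}) (E2 : {set {set cell}}) (c : cell) : bool :=
  (c \in E1) || [exists e in E2, c \in e].

Definition nondegenerate (c d : cell) : bool :=
  (c.1 != d.1) && (c.2 != d.2).

Definition gen_C4_nondegenerate (E1 : {set cell}) (E2 : {set {set cell}}) :
  bool :=
  [exists i : 'I_m, exists j : 'I_n, exists k : 'I_m, exists l : 'I_n,
    [&& [set (i, j); (k, l)] \in E2, nondegenerate (i, j) (k, l),
        occupied E1 E2 (i, l) & occupied E1 E2 (k, j)]].

Definition gen_C4_five_cells (E1 : {set cell}) (E2 : {set {set cell}}) : bool :=
  [exists i : 'I_m, exists j : 'I_n, exists p : 'I_m, exists q : 'I_n,
   exists k : 'I_m, exists l : 'I_n,
    let cells := [:: (k, l); (k, j); (k, q); (i, l); (p, l)] in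
    [&& [set (i, j); (p, q)] \in E2,
        k \notin [:: i; p], l \notin [:: j; q],
        all (occupied E1 E2) cells
      & nondegenerate (i, j) (p, q) ==> uniq cells]].

Definition has_generalized_C4 (E1 : {set cell}) (E2 : {set {set cell}}) : bool :=
  [|| has_C4 E1, gen_C4_nondegenerate E1 E2 | gen_C4_five_cells E1 E2].

(* The range is never empty: an extremal E1 with E2 empty is admissible. *)
Definition limited_zarankiewicz : nat :=
  \max_(G : {set cell} * {set {set cell}} |
        limited_augmented G.1 G.2 && ~~ has_generalized_C4 G.1 G.2)
    (#|G.1| + #|G.2|).

End Zarankiewicz.

(* Main.v *)
Require Import Defs.
From mathcomp Require Import all_boot.

(** A 6 x 6 arrangement with 16 1-edges and 4 2-edges does the job (a dot is an
    empty cell, 1 is a 1-edge, and equal letters are the halves of a 2-edge):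
[[
      1 1 a b . .
      . . 1 1 a b
      1 c 1 . 1 .
      . 1 . 1 1 c
      d 1 1 . . 1
      1 . . 1 d 1
]]
    Since a limited augmented graph must be built on an extremal C4-free graph,
    one also has to know that 16 is the largest number of edges of a C4-free
    graph on 6 + 6 vertices. This is the usual double counting: two rows of a
    C4-free graph have no pair of columns in common, so the row sizes d_i
    satisfy \sum_i C(d_i, 2) <= C(6, 2) = 15 ([sum_row_pairs]); as
    2 d <= C(d, 2) + 3 for every d, the number e of edges satisfies
    2 e <= 15 + 3 * 6 = 33 ([C4_free_card]).

    The properties of the arrangement are decidable, but finite sets do not
    compute. The arrangement is therefore given by lists of cells, each property
    is deduced from a boolean test on these lists, and the tests are evaluated. *)

(** * The upper bound on the number of edges of a C4-free graph *)

Definition row_support {m n} (E1 : {set cell m n}) (i : 'I_m) : {set 'I_n} :=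
  [set j | (i, j) \in E1].

Lemma card_rows {m n} (E1 : {set cell m n}) :
  #|E1| = \sum_(i < m) #|row_support E1 i|.
Proof.
rewrite -sum1_card (eq_bigl (fun c => (c.1, c.2) \in E1)); last by case.
rewrite -(pair_big_dep xpredT (fun i j => (i, j) \in E1) (fun _ _ => 1)) /=.
by apply: eq_bigr => i _; rewrite -sum1_card; apply: eq_bigl => j; rewrite inE.
Qed.

(** A pair of columns lies in at most one row of a C4-free graph, so counting
    the pairs row by row counts each pair of columns at most once. *)
Lemma sum_row_pairs {m n} (E1 : {set cell m n}) : ~~ has_C4 E1 ->
  \sum_(i < m) 'C(#|row_support E1 i|, 2) <= 'C(n, 2).
Proof.
move=> noC4.
have -> : 'C(n, 2) = \sum_(A : {set 'I_n} | #|A| == 2) 1.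
  by rewrite sum1dep_card card_draws card_ord.
rewrite (eq_bigr (fun i : 'I_m => \sum_(A : {set 'I_n} | #|A| == 2)
                                    (A \subset row_support E1 i))); last first.
  move=> i _; rewrite -cards_draws -sum1_card big_mkcond [RHS]big_mkcond /=.
  by apply: eq_bigr => A _; rewrite inE andbC; case: eqP => //= _; case: ifP.
rewrite exchange_big /=; apply: leq_sum => A /cards2P [j [l [neq_jl ->]]].
have [/existsP[i Ai] | /existsPn none] :=
  boolP [exists i, [set j; l] \subset row_support E1 i]; last first.
  by rewrite big1 // => i _; rewrite (negbTE (none i)).
rewrite (bigD1 i) //= Ai big1 // => k neq_ki.
apply/eqP; rewrite eqb0; apply: contra noC4 => Ak.
move: Ai Ak; rewrite !subUset !sub1set !inE => /andP[ij il] /andP[kj kl].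
apply/existsP; exists i; apply/existsP; exists k.
apply/existsP; exists j; apply/existsP; exists l.
by rewrite eq_sym neq_ki neq_jl ij il kj kl.
Qed.

(** The difference of the two sides is (d - 2) (d - 3) / 2. *)
Lemma double_leq_bin2 d : 2 * d <= 'C(d, 2) + 3.
Proof.
case: d => [|[|d]] //; elim: d => // d IHd.
rewrite binS bin1 mulnS addnAC (addnC 2).
case: d IHd => // d IHd.
by apply: leq_add.
Qed.

Lemma C4_free_card {m n} (E1 : {set cell m n}) : ~~ has_C4 E1 ->
  2 * #|E1| <= 'C(n, 2) + 3 * m.
Proof.
move=> noC4; rewrite card_rows big_distrr /=.
apply: (@leq_trans (\sum_(i < m) ('C(#|row_support E1 i|, 2) + 3))).
  by apply: leq_sum => i _; apply: double_leq_bin2.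
rewrite big_split /= sum_nat_const card_ord (mulnC m).
by rewrite leq_add2r sum_row_pairs.
Qed.

Lemma zarankiewicz66_le : zarankiewicz 6 6 <= 16.
Proof.
apply/bigmax_leqP => E1 /C4_free_card bound.
by rewrite -ltnS -(@ltn_pmul2l 2) // ltnS.
Qed.

(** * Augmented graphs given by lists of cells *)

Definition one_set {m n} (ones : seq (cell m n)) : {set cell m n} :=
  [set c in ones].

Definition two_set {m n} (twos : seq (cell m n * cell m n)) :
    {set {set cell m n}} :=
  [set [set e.1; e.2] | e in twos].

Definition orientations {T : eqType} (s : seq (T * T)) :=
  s ++ [seq (e.2, e.1) | e <- s].

Definition occupied_cells {m n} (ones : seq (cell m n)) twos :=
  ones ++ [seq e.1 | e <- orientations twos].

(** One test serves two kinds of cycle: c and d are two 1-edges in a classical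
    C4, and the two halves of a 2-edge in a cycle through a nondegenerate one. *)
Definition spans_rectangle {m n} (s : seq (cell m n)) (c d : cell m n) :=
  [&& nondegenerate c d, (c.1, d.2) \in s & (d.1, c.2) \in s].

(** The 2-edge has halves c and d, and x is the cell off their rows and columns. *)
Definition closes_five_cells {m n} (s : seq (cell m n)) (c d x : cell m n) :=
  [&& x.1 \notin [:: c.1; d.1], x.2 \notin [:: c.2; d.2] &
      all (mem s) [:: x; (x.1, c.2); (x.1, d.2); (c.1, x.2); (d.1, x.2)]].

Definition disjoint_pairs {T : eqType} (e f : T * T) :=
  ~~ has (mem [:: e.1; e.2]) [:: f.1; f.2].

Lemma eq_set2 (T : finType) (a b c d : T) :
  [set a; b] = [set c; d] -> (c, d) = (a, b) \/ (c, d) = (b, a).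
Proof.
move=> eq_sets.
have := set21 c d; have := set22 c d; have := set21 a b; have := set22 a b.
rewrite {1 2}eq_sets -{3 4}eq_sets !inE.
by do 4![case/orP=> /eqP ?]; subst; auto.
Qed.

(** The cycle conditions name a 2-edge by its halves in an arbitrary order. *)
Lemma two_setP {m n} (twos : seq (cell m n * cell m n)) c d :
  [set c; d] \in two_set twos -> (c, d) \in orientations twos.
Proof.
case/imsetP => -[a b] ab_twos /esym /eq_set2 /= eq_cd; rewrite mem_cat.
apply/orP; case: eq_cd => -[-> ->]; [by left | right].
by apply/mapP; exists (a, b).
Qed.

Lemma occupiedP {m n} (ones : seq (cell m n)) twos c :
  occupied (one_set ones) (two_set twos) c -> c \in occupied_cells ones twos.
Proof.
rewrite /occupied inE mem_cat map_cat mem_cat => /orP[-> // | /exists_inP[e]].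
case/imsetP => p p_twos ->; rewrite !inE => /orP[]/eqP->; apply/or3P.
  by apply: Or32; apply: map_f.
by apply: Or33; apply/mapP; exists (p.2, p.1) => //; apply/mapP; exists p.
Qed.

(** A C4 is determined by two opposite corners, so pairs of 1-edges suffice. *)
Lemma one_set_no_C4 {m n} (ones : seq (cell m n)) :
  {in ones &, forall c d, ~~ spans_rectangle ones c d} ->
  ~~ has_C4 (one_set ones).
Proof.
move=> no_rect; apply/existsP => -[i /existsP[k /existsP[j /existsP[l]]]].
rewrite !inE => /and5P[neq_ik neq_jl ij il /andP[kj kl]].
by have /negP[] := no_rect _ _ ij kl; apply/and3P; split=> //; apply/andP.
Qed.

Lemma two_set_no_gen_C4 {m n} (ones : seq (cell m n)) twos :
  (let occ := occupied_cells ones twos in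
   {in orientations twos, forall e, ~~ spans_rectangle occ e.1 e.2}) ->
  ~~ gen_C4_nondegenerate (one_set ones) (two_set twos).
Proof.
move=> no_rect; apply/existsP => -[i /existsP[j /existsP[k /existsP[l]]]].
case/and4P => /two_setP /no_rect /negP no_e nondeg /occupiedP il /occupiedP kj.
by apply: no_e; apply/and3P.
Qed.

Lemma two_set_no_five_cells {m n} (ones : seq (cell m n)) twos :
  (let occ := occupied_cells ones twos in
   {in orientations twos & occ, forall e x,
      ~~ closes_five_cells occ e.1 e.2 x}) ->
  ~~ gen_C4_five_cells (one_set ones) (two_set twos).
Proof.
move=> no_cycle; apply/existsP => -[i /existsP[j /existsP[p /existsP[q]]]].
case/existsP=> k /existsP[l] /and5P[/two_setP ijpq k_new l_new occ_cells _].
have {}occ_cells: all (mem (occupied_cells ones twos))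
    [:: (k, l); (k, j); (k, q); (i, l); (p, l)].
  by apply: sub_all occ_cells => c; apply: occupiedP.
have /andP[kl _] := occ_cells.
by have /negP[] := no_cycle _ _ ijpq kl; apply/and3P.
Qed.

Lemma disjoint_set2 (T : finType) (e f : T * T) :
  disjoint_pairs e f -> [disjoint [set e.1; e.2] & [set f.1; f.2]].
Proof.
move=> disj_ef; apply/pred0P => x /=; apply: contraNF disj_ef.
rewrite /= !inE => /andP[e_x]; case/orP=> /eqP <-.
  by rewrite e_x.
by rewrite e_x orbT.
Qed.

Lemma two_set_simplicity {m n} (ones : seq (cell m n)) twos :
  {in twos, forall e, (e.1 \notin ones) && (e.2 \notin ones)} ->
  {in twos &, forall e f, (e == f) || disjoint_pairs e f} ->
  simplicity (one_set ones) (two_set twos).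
Proof.
move=> off_ones disj; apply/andP; split.
  apply/forall_inP => _ /imsetP[e e_twos ->].
  have /andP[not1 not2] := off_ones e e_twos.
  by rewrite disjoints_subset subUset !sub1set !inE not1.
apply/forall_inP => _ /imsetP[e e_twos ->].
apply/forall_inP => _ /imsetP[f f_twos ->]; apply/implyP.
by case/orP: (disj e f e_twos f_twos) => [/eqP-> /eqP // | /disjoint_set2].
Qed.

(** Disjoint pairs share no half, so different entries give different 2-edges. *)
Lemma card_two_set {m n} (twos : seq (cell m n * cell m n)) :
  uniq twos -> {in twos &, forall e f, (e == f) || disjoint_pairs e f} ->
  #|two_set twos| = size twos.
Proof.
move=> uniq_twos disj; rewrite card_in_imset; first exact/card_uniqP.
move=> e f e_twos f_twos eq_sets.
case/orP: (disj e f e_twos f_twos) => [/eqP // | /disjoint_set2].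
by rewrite eq_sets => /pred0P/(_ f.1); rewrite /= set21.
Qed.

(** * The arrangement *)

(** Reducing modulo 6 bounds the coordinates whatever i and j are, so that cells
    are built from plain numerals and their values still compute. *)
Definition cell66 (i j : nat) : cell 6 6 :=
  (Ordinal (ltn_pmod i (isT : 0 < 6)), Ordinal (ltn_pmod j (isT : 0 < 6))).

Definition ones66 : seq (cell 6 6) :=
  [:: cell66 0 0; cell66 0 1;
      cell66 1 2; cell66 1 3;
      cell66 2 0; cell66 2 2; cell66 2 4;
      cell66 3 1; cell66 3 3; cell66 3 4;
      cell66 4 1; cell66 4 2; cell66 4 5;
      cell66 5 0; cell66 5 3; cell66 5 5].

Definition twos66 : seq (cell 6 6 * cell 6 6) :=
  [:: (cell66 0 2, cell66 1 4); (cell66 0 3, cell66 1 5);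
      (cell66 2 1, cell66 3 5); (cell66 4 0, cell66 5 4)].

Lemma ones66_no_C4 : ~~ has_C4 (one_set ones66).
Proof. by apply: one_set_no_C4; apply/allrelP; vm_compute. Qed.

Lemma card_ones66 : #|one_set ones66| = 16.
Proof. by rewrite cardsE; apply/card_uniqP; vm_compute. Qed.

Lemma zarankiewicz66 : zarankiewicz 6 6 = 16.
Proof.
apply/eqP; rewrite eqn_leq zarankiewicz66_le -card_ones66.
exact: (leq_bigmax_cond (one_set ones66) ones66_no_C4).
Qed.

Lemma twos66_disjoint :
  {in twos66 &, forall e f, (e == f) || disjoint_pairs e f}.
Proof. by apply/allrelP; vm_compute. Qed.

Lemma card_twos66 : #|two_set twos66| = 4.
Proof. by rewrite card_two_set //; apply: twos66_disjoint. Qed.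

Lemma limited_augmented66 :
  limited_augmented (one_set ones66) (two_set twos66).
Proof.
apply/and4P; split; first exact: ones66_no_C4.
- by rewrite card_ones66 zarankiewicz66.
- apply/forall_inP => _ /imsetP[e e_twos ->]; rewrite cards2 eqSS eqb1.
  by move: e e_twos; apply/allP; vm_compute.
- apply: two_set_simplicity twos66_disjoint.
  by apply/allP; vm_compute.
Qed.

Lemma no_generalized_C4_66 :
  ~~ has_generalized_C4 (one_set ones66) (two_set twos66).
Proof.
apply/norP; split; first exact: ones66_no_C4.
apply/norP; split.
  by apply: two_set_no_gen_C4; apply/allP; vm_compute.
by apply: two_set_no_five_cells; apply/allrelP; vm_compute.
Qed.

Theorem mainTheorem8 : 20 <= limited_zarankiewicz 6 6.
Proof.
apply: (bigmax_sup (one_set ones66, two_set twos66)).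
  by rewrite limited_augmented66 no_generalized_C4_66.
by rewrite card_ones66 card_twos66.
Qed.
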